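(* Let $(v_n)_{n\ge0}$ and $(u_n)_{n\ge0}$ be the two sequences that both satisfy the recurrence $a_{n+2}=\sum_{k=0}^n\binom nk2^{\,n-k}a_k$ for all $n\ge0$, with initial conditions $(v_0,v_1)=(1,0)$ and $(u_0,u_1)=(0,1)$. Then $$I_0(e^x)=\sum_{n=0}^\infty S(n)\frac{x^n}{n!},\qquad\text{where}\qquad S(n)=\sum_{k=0}^\infty\frac{(2k)^n}{(2^kk!)^2}=v_nI_0(1)+u_nI_1(1)\quad(n\ge 0).$$
   Context: $I_0,I_1$ are the modified Bessel functions of the first kind of orders $0$ and $1$. The convention $0^0=1$ is used, so the $k=0$ term of $S(n)$ is $\delta_{n,0}$. (The sequences $v,u$ are the primitive $2$-Bell sequences $B^{(2,0)},B^{(2,1)}$, OEIS A351143 and A351028.) *)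

(* Defs.v *)
From Stdlib Require Export Reals Factorial.
From Coquelicot Require Export Coquelicot.

Open Scope R_scope.

Definition Cexp (z : C) : C :=
  (exp (Re z) * cos (Im z), exp (Re z) * sin (Im z)).

(** The sum of a complex series, total like Coquelicot's [Series]: it is the
    sum when the real and imaginary parts converge, and junk otherwise. *)
Definition CSeries (a : nat -> C) : C :=
  (Series (fun k => Re (a k)), Series (fun k => Im (a k))).

(** Modified Bessel function of the first kind of integer order [nu >= 0];
    [Gamma (k + nu + 1)] is written [(k + nu)!]. *)
Definition BesselI (nu : nat) (z : C) : C :=
  CSeries (fun k =>
    ((z / 2) ^ (2 * k + nu) / RtoC (INR (fact k) * INR (fact (k + nu))))%C).

(** [a_(n+2) = sum_(k=0..n) binom(n,k) 2^(n-k) a_k]; [Binomial.C n k] is the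
    binomial coefficient, the bare [C] being the complex numbers. *)
Definition bell2_rec (a : nat -> R) : Prop :=
  forall n : nat,
    a (n + 2)%nat = sum_n (fun k => Binomial.C n k * 2 ^ (n - k) * a k) n.

(** [0 ^ 0 = 1] for [pow], so [S_term 0 0 = 1] and [S_term n 0 = 0] for
    [n > 0]. *)
Definition S_term (n k : nat) : R :=
  INR (2 * k) ^ n / (2 ^ k * INR (fact k)) ^ 2.

Definition S_sum (n : nat) : R := Series (S_term n).

(* Main.v *)
Require Import Defs.
From Stdlib Require Import Arith Lra Lia.

(** Put [w_k = 1 / (2^k k!)^2], so that [I_0(z) = sum_k w_k z^(2k)].  Then
    [S(n) = sum_k w_k (2k)^n] is the [n]-th moment of the measure that puts
    mass [w_k] at the point [2k], and [I_0(e^x) = sum_k w_k e^(2k x)] is the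
    moment generating function of that measure.  The first claim is the
    expansion of a moment generating function in moments
    ([is_series_complex_moments]), valid on the whole complex plane since
    [w_k] decays fast enough for every [sum_k w_k e^(2k L)] to converge.

    The exchange of the sums over [k] and [n] is made quantitative.  By
    [exp_rest_bound] the real and imaginary parts of
    [e^(tz) - sum_(n<=N) (tz)^n/n!] are at most
    [e^(tM) (tM)^(N+1)/(N+1)!], where [M = |Re z| + |Im z|] and [t >= 0];
    since [(2tM)^(N+1)/(N+1)! <= e^(2tM)], this is at most
    [2^-(N+1) e^(3tM)].  Summed against [w_k] at [t = 2k], the error after [N]
    terms is [2^-(N+1)] times a finite constant.

    For the second claim, [w_(k+1) (2k+2)^2 = w_k] gives
    [S(n+2) = sum_k w_k (2k+2)^n], and the binomial theorem turns this into the
    2-Bell recurrence for [S].  A solution of the recurrence is determined by,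
    and linear in, its first two values, and [S(0) = I_0(1)],
    [S(1) = I_1(1)]. *)

(** * Taylor remainders of the complex exponential *)

Lemma Rabs_le_of_derive_le (f g f' g' : R -> R) (t : R) :
  0 <= t ->
  (forall s, 0 <= s -> is_derive f s (f' s)) ->
  (forall s, 0 <= s -> is_derive g s (g' s)) ->
  (forall s, 0 <= s -> Rabs (f' s) <= g' s) ->
  Rabs (f 0) <= g 0 ->
  Rabs (f t) <= g t.
Proof.
  intros Ht Hf Hg Hd H0.
  (* The mean value theorem, to be used for [g - f] and [g + f]. *)
  assert (Hmono : forall h h' : R -> R,
      (forall s, 0 <= s -> is_derive h s (h' s)) ->
      (forall s, 0 <= s -> 0 <= h' s) -> h 0 <= h t).
  { intros h h' Hh Hp.
    destruct (MVT_gen h 0 t h') as [c [Hc Heq]].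
    - intros s Hs. apply Hh. rewrite Rmin_left in Hs; lra.
    - intros s Hs. rewrite Rmin_left in Hs by lra.
      apply continuity_pt_filterlim, (ex_derive_continuous h).
      exists (h' s). apply Hh. lra.
    - rewrite Rmin_left in Hc by lra.
      assert (0 <= h' c) by (apply Hp; lra). nra. }
  assert (H1 : g 0 - f 0 <= g t - f t).
  { apply (Hmono (fun s => g s - f s) (fun s => g' s - f' s)).
    - intros s Hs. apply @is_derive_minus; auto.
    - intros s Hs. specialize (Hd s Hs). apply Rabs_le_between in Hd. lra. }
  assert (H2 : g 0 + f 0 <= g t + f t).
  { apply (Hmono (fun s => g s + f s) (fun s => g' s + f' s)).
    - intros s Hs. apply @is_derive_plus; auto.
    - intros s Hs. specialize (Hd s Hs). apply Rabs_le_between in Hd. lra. }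
  apply Rabs_le_between in H0. apply Rabs_le_between. lra.
Qed.

Lemma exp_le_compat (x y : R) : x <= y -> exp x <= exp y.
Proof. intros [H | ->]; [apply Rlt_le, exp_increasing, H | apply Rle_refl]. Qed.

(** With [M = |Re z| + |Im z|], this dominates both components of the
    remainder of [e^(tz)] after its first [N] Taylor terms.  The factor
    [e^(tM)] is kept inside, instead of a supremum over an interval, so that
    the bound holds for all [t >= 0] at once. *)
Definition exp_bound (M : R) (N : nat) (t : R) : R :=
  exp (t * M) * ((t * M) ^ N / INR (fact N)).

(** Passing to the next Taylor remainder is integrating
    [F1 + i G1 = int_0^t (a + i b) (F + i G)].  Each component of
    [(a + i b) (F + i G)] is at most [(|a| + |b|) exp_bound N], which is at
    most the derivative of [exp_bound (N + 1)]. *)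
Lemma exp_bound_step (a b : R) (F G F1 G1 : R -> R) (N : nat) :
  (forall t, 0 <= t -> Rabs (F t) <= exp_bound (Rabs a + Rabs b) N t) ->
  (forall t, 0 <= t -> Rabs (G t) <= exp_bound (Rabs a + Rabs b) N t) ->
  (forall t, is_derive F1 t (a * F t - b * G t)) ->
  (forall t, is_derive G1 t (a * G t + b * F t)) ->
  F1 0 = 0 -> G1 0 = 0 ->
  forall t, 0 <= t ->
    Rabs (F1 t) <= exp_bound (Rabs a + Rabs b) (S N) t /\
    Rabs (G1 t) <= exp_bound (Rabs a + Rabs b) (S N) t.
Proof.
  intros HF HG HF1 HG1 F0 G0 t Ht.
  set (M := Rabs a + Rabs b) in *.
  assert (HM : 0 <= M)
    by (unfold M; generalize (Rabs_pos a), (Rabs_pos b); lra).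
  set (B' := fun s => M * exp_bound M (S N) s + M * exp_bound M N s).
  assert (HB : forall s, 0 <= s -> is_derive (exp_bound M (S N)) s (B' s)).
  { intros s _. unfold B', exp_bound. auto_derive; [easy|].
    change (match N with 0%nat => 1 | S _ => INR N + 1 end) with (INR (S N)).
    change (fact N + N * fact N)%nat with (S N * fact N)%nat.
    rewrite fact_simpl, !mult_INR, <- tech_pow_Rmult.
    field. split; [apply INR_fact_neq_0 | apply not_0_INR; lia]. }
  assert (Hpos : forall s, 0 <= s -> 0 <= exp_bound M (S N) s).
  { intros s Hs. unfold exp_bound. apply Rmult_le_pos; [apply Rlt_le, exp_pos|].
    apply Rdiv_le_0_compat; [apply pow_le; nra | apply INR_fact_lt_0]. }
  assert (H00 : exp_bound M (S N) 0 = 0).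
  { unfold exp_bound. rewrite Rmult_0_l, pow_i by lia. unfold Rdiv; ring. }
  assert (Hlin : forall s x y, 0 <= s ->
      Rabs x <= exp_bound M N s -> Rabs y <= exp_bound M N s ->
      Rabs (a * x + b * y) <= B' s).
  { intros s x y Hs Hx Hy. unfold B'.
    assert (0 <= M * exp_bound M (S N) s)
      by (apply Rmult_le_pos; [easy | apply Hpos; easy]).
    eapply Rle_trans; [apply Rabs_triang|]. rewrite !Rabs_mult.
    assert (Rabs a * Rabs x <= Rabs a * exp_bound M N s)
      by (apply Rmult_le_compat_l; [apply Rabs_pos | easy]).
    assert (Rabs b * Rabs y <= Rabs b * exp_bound M N s)
      by (apply Rmult_le_compat_l; [apply Rabs_pos | easy]).
    unfold M at 3. lra. }
  split.
  - apply (Rabs_le_of_derive_le F1 _ (fun s => a * F s - b * G s) B'); auto.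
    + intros s Hs. replace (a * F s - b * G s) with (a * F s + b * - G s) by ring.
      apply Hlin; auto. rewrite Rabs_Ropp; auto.
    + rewrite F0, H00, Rabs_R0. lra.
  - apply (Rabs_le_of_derive_le G1 _ (fun s => a * G s + b * F s) B'); auto.
    rewrite G0, H00, Rabs_R0. lra.
Qed.

Definition exp_coef (z : C) (n : nat) : C := (z ^ n / RtoC (INR (fact n)))%C.

Lemma exp_coef_components (z : C) (n : nat) :
  exp_coef z n = (Re (z ^ n) / INR (fact n), Im (z ^ n) / INR (fact n)).
Proof.
  unfold exp_coef. assert (INR (fact n) <> 0) by apply INR_fact_neq_0.
  destruct (z ^ n)%C as [p q].
  unfold Cdiv, Cinv, Cmult, RtoC, Re, Im; simpl. f_equal; field; auto.
Qed.

Lemma exp_coef_S (z : C) (n : nat) :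
  (INR (S n) * Re (exp_coef z (S n)) =
     Re z * Re (exp_coef z n) - Im z * Im (exp_coef z n)) /\
  (INR (S n) * Im (exp_coef z (S n)) =
     Re z * Im (exp_coef z n) + Im z * Re (exp_coef z n)).
Proof.
  rewrite !exp_coef_components.
  rewrite Cpow_S, fact_simpl, mult_INR.
  assert (INR (fact n) <> 0) by apply INR_fact_neq_0.
  assert (INR (S n) <> 0) by (apply not_0_INR; lia).
  destruct (z ^ n)%C as [p q], z as [a b].
  unfold Cmult, Re, Im. cbn [fst snd]. split; field; auto.
Qed.

(** The form of term-by-term differentiation in which the derivative of the
    Taylor polynomial of degree [N + 1] is expressed by the one of degree
    [N]. *)
Lemma is_derive_power_sum (p d : nat -> R) (N : nat) (t : R) :
  (forall n, INR (S n) * p (S n) = d n) ->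
  is_derive (fun s => sum_n (fun n => s ^ n * p n) (S N)) t
    (sum_n (fun n => t ^ n * d n) N).
Proof.
  intros Hd. induction N as [|N IH].
  - apply (is_derive_ext (fun s => p 0%nat + s * p 1%nat)).
    { intros s. rewrite sum_Sn, sum_O. unfold plus; simpl. ring. }
    rewrite sum_O, <- Hd. simpl. auto_derive; [easy|]. ring.
  - apply (is_derive_ext (fun s => sum_n (fun n => s ^ n * p n) (S N)
                                  + s ^ (S (S N)) * p (S (S N)))).
    { intros s. rewrite (sum_Sn _ (S N)). reflexivity. }
    rewrite (sum_Sn _ N). apply @is_derive_plus; [exact IH|].
    rewrite <- Hd. auto_derive; [easy|].
    rewrite (S_INR (S N)). simpl. ring.
Qed.

Lemma sum_n_pow_0 (p : nat -> R) (N : nat) :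
  sum_n (fun n => 0 ^ n * p n) N = p 0%nat.
Proof.
  induction N as [|N IH].
  - rewrite sum_O. simpl. ring.
  - rewrite sum_Sn, IH, pow_i by lia. unfold plus; simpl. ring.
Qed.

Definition exp_rest (z : C) (N : nat) (t : R) : C :=
  (Re (Cexp (RtoC t * z)) - sum_n (fun n => t ^ n * Re (exp_coef z n)) N,
   Im (Cexp (RtoC t * z)) - sum_n (fun n => t ^ n * Im (exp_coef z n)) N).

Lemma Cexp_ray (z : C) (t : R) :
  Cexp (RtoC t * z) =
    (exp (t * Re z) * cos (t * Im z), exp (t * Re z) * sin (t * Im z)).
Proof.
  destruct z as [a b]. unfold Cexp, Cmult, RtoC, Re, Im; simpl.
  rewrite !Rmult_0_l, Rminus_0_r, Rplus_0_r. reflexivity.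
Qed.

Lemma is_derive_Cexp_ray (z : C) (t : R) :
  is_derive (fun s => Re (Cexp (RtoC s * z))) t
    (Re z * Re (Cexp (RtoC t * z)) - Im z * Im (Cexp (RtoC t * z))) /\
  is_derive (fun s => Im (Cexp (RtoC s * z))) t
    (Re z * Im (Cexp (RtoC t * z)) + Im z * Re (Cexp (RtoC t * z))).
Proof.
  destruct z as [a b]. rewrite Cexp_ray. cbn [Re Im fst snd]. split.
  - apply (is_derive_ext (fun s => exp (s * a) * cos (s * b))).
    { intros s. now rewrite Cexp_ray. }
    auto_derive; [easy|]. ring.
  - apply (is_derive_ext (fun s => exp (s * a) * sin (s * b))).
    { intros s. now rewrite Cexp_ray. }
    auto_derive; [easy|]. ring.
Qed.

Lemma Rabs_Cexp_ray (z : C) (t : R) :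
  0 <= t ->
  Rabs (Re (Cexp (RtoC t * z))) <= exp (t * (Rabs (Re z) + Rabs (Im z))) /\
  Rabs (Im (Cexp (RtoC t * z))) <= exp (t * (Rabs (Re z) + Rabs (Im z))).
Proof.
  intros Ht. rewrite Cexp_ray. destruct z as [a b]. cbn [Re Im fst snd].
  assert (He : exp (t * a) <= exp (t * (Rabs a + Rabs b))).
  { apply exp_le_compat. generalize (Rle_abs a), (Rabs_pos b). nra. }
  assert (Hp := exp_pos (t * a)).
  assert (Hc : Rabs (cos (t * b)) <= 1)
    by (apply Rabs_le_between; generalize (COS_bound (t * b)); lra).
  assert (Hs : Rabs (sin (t * b)) <= 1)
    by (apply Rabs_le_between; generalize (SIN_bound (t * b)); lra).
  rewrite !Rabs_mult, (Rabs_pos_eq _ (Rlt_le _ _ Hp)).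
  split; nra.
Qed.

(** Induction on [N]: the derivative of [t |-> exp_rest z (N + 1) t] is
    [z * exp_rest z N t], and [exp_rest] vanishes at [t = 0], so
    [exp_bound_step] applies.  The induction starts one stage earlier, from
    [Cexp (t z)] itself, the remainder after no term at all. *)
Lemma exp_rest_bound (z : C) (N : nat) (t : R) :
  0 <= t ->
  Rabs (Re (exp_rest z N t)) <= exp_bound (Rabs (Re z) + Rabs (Im z)) (S N) t /\
  Rabs (Im (exp_rest z N t)) <= exp_bound (Rabs (Re z) + Rabs (Im z)) (S N) t.
Proof.
  assert (Hsum : forall (l : R) (x : nat -> R) (m : R) (y : nat -> R) K s,
     sum_n (fun n => s ^ n * (l * x n + m * y n)) K =
     l * sum_n (fun n => s ^ n * x n) K + m * sum_n (fun n => s ^ n * y n) K).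
  { intros l x m y K s. rewrite <- !(sum_n_mult_l (K := R_Ring)).
    rewrite <- (sum_n_plus (G := R_AbelianMonoid)).
    apply sum_n_ext. intros n. unfold plus, mult; simpl. ring. }
  revert t. induction N as [|N IH]; intros t Ht.
  - apply (exp_bound_step (Re z) (Im z)
             (fun s => Re (Cexp (RtoC s * z))) (fun s => Im (Cexp (RtoC s * z)))
             (fun s => Re (exp_rest z 0 s)) (fun s => Im (exp_rest z 0 s)));
      try exact Ht.
    + intros s Hs. unfold exp_bound. simpl. rewrite Rdiv_1_r, Rmult_1_r.
      now apply Rabs_Cexp_ray.
    + intros s Hs. unfold exp_bound. simpl. rewrite Rdiv_1_r, Rmult_1_r.
      now apply Rabs_Cexp_ray.
    + intros s.
      apply (is_derive_ext
        (fun s => minus (Re (Cexp (RtoC s * z))) (Re (exp_coef z 0)))).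
      { intros r. unfold exp_rest. cbn [Re Im fst snd].
        rewrite sum_O, pow_O, Rmult_1_l. reflexivity. }
      match goal with |- is_derive _ _ ?d => replace d with (d - 0) by ring end.
      apply @is_derive_minus;
        [apply is_derive_Cexp_ray | apply @is_derive_const].
    + intros s.
      apply (is_derive_ext
        (fun s => minus (Im (Cexp (RtoC s * z))) (Im (exp_coef z 0)))).
      { intros r. unfold exp_rest. cbn [Re Im fst snd].
        rewrite sum_O, pow_O, Rmult_1_l. reflexivity. }
      match goal with |- is_derive _ _ ?d => replace d with (d - 0) by ring end.
      apply @is_derive_minus;
        [apply is_derive_Cexp_ray | apply @is_derive_const].
    + unfold exp_rest. rewrite Cexp_ray, !sum_O, exp_coef_components.
      unfold Re, Im; simpl. rewrite !Rmult_0_l, exp_0, cos_0. field.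
    + unfold exp_rest. rewrite Cexp_ray, !sum_O, exp_coef_components.
      unfold Re, Im; simpl. rewrite !Rmult_0_l, exp_0, sin_0. field.
  - apply (exp_bound_step (Re z) (Im z)
             (fun s => Re (exp_rest z N s)) (fun s => Im (exp_rest z N s))
             (fun s => Re (exp_rest z (S N) s))
             (fun s => Im (exp_rest z (S N) s)));
      try exact Ht; try (intros s Hs; now apply IH).
    + intros s. unfold exp_rest at 2 3.
      match goal with |- is_derive _ _ ?d => replace d with
        ((Re z * Re (Cexp (RtoC s * z)) - Im z * Im (Cexp (RtoC s * z)))
         - sum_n (fun n => s ^ n * (Re z * Re (exp_coef z n)
                                    + - Im z * Im (exp_coef z n))) N) end.
      2: { rewrite Hsum. unfold Re, Im. cbn [fst snd]. ring. }
      apply @is_derive_minus; [apply is_derive_Cexp_ray|].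
      apply (is_derive_power_sum (fun n => Re (exp_coef z n))).
      intros n. rewrite (proj1 (exp_coef_S z n)). ring.
    + intros s. unfold exp_rest at 2 3.
      match goal with |- is_derive _ _ ?d => replace d with
        ((Re z * Im (Cexp (RtoC s * z)) + Im z * Re (Cexp (RtoC s * z)))
         - sum_n (fun n => s ^ n * (Re z * Im (exp_coef z n)
                                    + Im z * Re (exp_coef z n))) N) end.
      2: { rewrite Hsum. unfold Re, Im. cbn [fst snd]. ring. }
      apply @is_derive_minus; [apply is_derive_Cexp_ray|].
      apply (is_derive_power_sum (fun n => Im (exp_coef z n))).
      intros n. rewrite (proj2 (exp_coef_S z n)). ring.
    + unfold exp_rest. rewrite Cexp_ray. cbn [Re Im fst snd].
      rewrite (sum_n_pow_0 (fun n => Re (exp_coef z n))), exp_coef_components.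
      unfold Re, Im; simpl. rewrite !Rmult_0_l, exp_0, cos_0. field.
    + unfold exp_rest. rewrite Cexp_ray. cbn [Re Im fst snd].
      rewrite (sum_n_pow_0 (fun n => Im (exp_coef z n))), exp_coef_components.
      unfold Re, Im; simpl. rewrite !Rmult_0_l, exp_0, sin_0. field.
Qed.

Lemma pow_fact_le_exp (x : R) (n : nat) : 0 <= x -> x ^ n / INR (fact n) <= exp x.
Proof.
  intros Hx. eapply Rle_trans; [|apply (exp_ge_taylor x n Hx)].
  destruct n as [|n]; [simpl; lra|]. rewrite tech5.
  match goal with |- ?u <= ?s + ?u => assert (0 <= s); [|lra] end.
  apply cond_pos_sum. intros k.
  apply Rdiv_le_0_compat; [now apply pow_le | apply INR_fact_lt_0].
Qed.

(** A factor [2^-N] is traded for a larger exponent, using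
    [(2tM)^N / N! <= e^(2tM)]: the right-hand side is then geometric in [N]
    and can still be summed over [t] against fast decaying weights. *)
Lemma exp_bound_le (M t : R) (N : nat) :
  0 <= t -> 0 <= M -> exp_bound M N t <= (1 / 2) ^ N * exp (t * (3 * M)).
Proof.
  intros Ht HM. unfold exp_bound.
  assert (0 <= t * M) by nra.
  replace (t * (3 * M)) with (t * M + 2 * (t * M)) by ring.
  rewrite exp_plus.
  replace ((t * M) ^ N) with ((1 / 2) ^ N * (2 * (t * M)) ^ N)
    by (rewrite <- Rpow_mult_distr; f_equal; field).
  assert (H1 : (2 * (t * M)) ^ N / INR (fact N) <= exp (2 * (t * M)))
    by (apply pow_fact_le_exp; lra).
  assert (0 < (1 / 2) ^ N) by (apply pow_lt; lra).
  assert (He := exp_pos (t * M)).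
  replace (exp (t * M) * ((1 / 2) ^ N * (2 * (t * M)) ^ N / INR (fact N)))
    with ((1 / 2) ^ N * (exp (t * M) * ((2 * (t * M)) ^ N / INR (fact N))))
    by (unfold Rdiv; ring).
  apply Rmult_le_compat_l; [lra|]. apply Rmult_le_compat_l; lra.
Qed.

(** * Moments and generating functions *)

(** The extensionality lemmas on series produce equations whose type is a
    projection of a canonical structure on [R]; [ring] only accepts [R]
    itself. *)
Ltac real_ring :=
  match goal with |- ?x = ?y => change (@eq R x y) end;
  unfold plus, mult; simpl; ring.

Lemma is_series_C_components (a : nat -> C) (l : C) :
  is_series (fun n => Re (a n)) (Re l) -> is_series (fun n => Im (a n)) (Im l) ->
  is_series a l.
Proof.
  intros Hr Hi.
  assert (Hs : forall N, sum_n a N =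
            (sum_n (fun n => Re (a n)) N, sum_n (fun n => Im (a n)) N)).
  { induction N as [|N IH].
    - rewrite !sum_O. now destruct (a 0%nat).
    - rewrite !sum_Sn, IH. reflexivity. }
  apply filterlim_locally. intros eps.
  generalize (filter_and _ _ (proj1 (filterlim_locally _ _) Hr eps)
                             (proj1 (filterlim_locally _ _) Hi eps)).
  apply filter_imp. intros N [H1 H2]. rewrite Hs. split; assumption.
Qed.

(** A discrete measure on the nonnegative reals, with mass [w k] at [r k], all
    of whose exponential moments are finite. *)
Section Moments.

Variables w r : nat -> R.
Hypothesis w_pos : forall k, 0 <= w k.
Hypothesis r_pos : forall k, 0 <= r k.
Hypothesis exp_moments : forall L : R, ex_series (fun k => w k * exp (r k * L)).

Lemma ex_series_moment (n : nat) : ex_series (fun k => w k * r k ^ n).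
Proof.
  apply (ex_series_le (V := R_CompleteNormedModule) _
           (fun k => INR (fact n) * (w k * exp (r k * 1)))).
  - intros k. change (norm (w k * r k ^ n)) with (Rabs (w k * r k ^ n)).
    rewrite Rabs_pos_eq by (apply Rmult_le_pos; [apply w_pos | apply pow_le, r_pos]).
    assert (H := pow_fact_le_exp (r k) n (r_pos k)).
    apply Rle_div_l in H; [|apply INR_fact_lt_0].
    rewrite Rmult_1_r. generalize (w_pos k). nra.
  - apply (ex_series_scal (V := R_NormedModule)), exp_moments.
Qed.

Lemma is_series_sum_n_moments (p : nat -> R) (N : nat) :
  is_series (fun k => w k * sum_n (fun n => r k ^ n * p n) N)
    (sum_n (fun n => Series (fun k => w k * r k ^ n) * p n) N).
Proof.
  assert (Hterm : forall n, is_series (fun k => w k * (r k ^ n * p n))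
                    (Series (fun k => w k * r k ^ n) * p n)).
  { intros n. apply (is_series_ext (fun k => (w k * r k ^ n) * p n)).
    - intros k. apply Rmult_assoc.
    - apply is_series_scal_r, Series_correct, ex_series_moment. }
  induction N as [|N IH].
  - rewrite sum_O. apply (is_series_ext (fun k => w k * (r k ^ 0 * p 0%nat))).
    + intros k. now rewrite sum_O.
    + apply Hterm.
  - rewrite sum_Sn.
    apply (is_series_ext (fun k => plus (w k * sum_n (fun n => r k ^ n * p n) N)
                                    (w k * (r k ^ S N * p (S N))))).
    + intros k. rewrite sum_Sn. real_ring.
    + now apply @is_series_plus.
Qed.

(** Exchange of [sum_k] and [sum_n] for a function [f] whose expansion
    converges geometrically, with a constant that may grow exponentially with
    the argument: the error after [N] terms is at most
    [2^-(N+1) sum_k w_k e^(r_k L)]. *)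
Lemma is_series_moments (f : R -> R) (p : nat -> R) (L : R) :
  (forall t N, 0 <= t ->
     Rabs (f t - sum_n (fun n => t ^ n * p n) N) <= (1 / 2) ^ S N * exp (t * L)) ->
  is_series (fun n => Series (fun k => w k * r k ^ n) * p n)
    (Series (fun k => w k * f (r k))).
Proof.
  intros Hf.
  set (rest := fun N k => w k * (f (r k) - sum_n (fun n => r k ^ n * p n) N)).
  assert (Hrest : forall N k,
     Rabs (rest N k) <= (1 / 2) ^ S N * (w k * exp (r k * L))).
  { intros N k. unfold rest. rewrite Rabs_mult, (Rabs_pos_eq _ (w_pos k)).
    generalize (Hf (r k) N (r_pos k)), (w_pos k). nra. }
  assert (Hexp : forall N,
    ex_series (fun k => (1 / 2) ^ S N * (w k * exp (r k * L))))
    by (intros N; apply (ex_series_scal (V := R_NormedModule)), exp_moments).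
  assert (Habs : forall N, ex_series (fun k => Rabs (rest N k))).
  { intros N. apply (ex_series_le (V := R_CompleteNormedModule) _ _)
      with (2 := Hexp N).
    intros k. change (norm (Rabs (rest N k))) with (Rabs (Rabs (rest N k))).
    rewrite Rabs_Rabsolu. apply Hrest. }
  assert (Hdiff : forall N, Series (fun k => w k * f (r k)) =
     Series (rest N) + sum_n (fun n => Series (fun k => w k * r k ^ n) * p n) N).
  { intros N. apply is_series_unique.
    apply (is_series_ext (fun k => plus (rest N k)
                            (w k * sum_n (fun n => r k ^ n * p n) N))).
    - intros k. unfold rest. real_ring.
    - apply @is_series_plus; [|apply is_series_sum_n_moments].
      apply Series_correct, ex_series_Rabs, Habs. }
  set (E := Series (fun k => w k * exp (r k * L))).
  assert (Hlim : is_lim_seq (fun N => (1 / 2) ^ S N * E) 0).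
  { replace (Finite 0) with (Rbar_mult 0 E) by (simpl; f_equal; ring).
    apply is_lim_seq_scal_r.
    apply (is_lim_seq_incr_1 (fun N => (1 / 2) ^ N)), is_lim_seq_geom.
    rewrite Rabs_pos_eq; lra. }
  assert (Hle : forall N, Rabs (Series (rest N)) <= (1 / 2) ^ S N * E).
  { intros N. eapply Rle_trans; [apply Series_Rabs, Habs|].
    unfold E. rewrite <- Series_scal_l. apply Series_le; [|apply Hexp].
    intros k. split; [apply Rabs_pos | apply Hrest]. }
  assert (H0 : is_lim_seq (fun N => Series (rest N)) 0).
  { apply is_lim_seq_abs_0.
    apply (is_lim_seq_le_le (fun _ => 0) (fun N => Rabs (Series (rest N)))
             (fun N => (1 / 2) ^ S N * E));
      [|apply is_lim_seq_const | exact Hlim].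
    intros N. split; [apply Rabs_pos | apply Hle]. }
  change (is_lim_seq (sum_n (fun n => Series (fun k => w k * r k ^ n) * p n))
            (Series (fun k => w k * f (r k)))).
  apply (is_lim_seq_ext (fun N => Series (fun k => w k * f (r k)) - Series (rest N))).
  - intros N. rewrite (Hdiff N). ring.
  - assert (H1 := is_lim_seq_minus' _ _ _ _
                    (is_lim_seq_const (Series (fun k => w k * f (r k)))) H0).
    rewrite Rminus_0_r in H1. exact H1.
Qed.

Lemma is_series_complex_moments (x : C) :
  is_series (fun n => (RtoC (Series (fun k => w k * r k ^ n)%R) * exp_coef x n)%C)
    (CSeries (fun k => (RtoC (w k) * Cexp (RtoC (r k) * x))%C)).
Proof.
  set (M := Rabs (Re x) + Rabs (Im x)).
  assert (HM : 0 <= M)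
    by (unfold M; generalize (Rabs_pos (Re x)), (Rabs_pos (Im x)); lra).
  assert (Hscal : forall (c : R) (z : C),
            Re (RtoC c * z) = c * Re z /\ Im (RtoC c * z) = c * Im z).
  { intros c [p q]. unfold Cmult, RtoC, Re, Im; simpl. split; ring. }
  apply is_series_C_components.
  - apply (is_series_ext
      (fun n => Series (fun k => w k * r k ^ n) * Re (exp_coef x n))).
    { intros n. symmetry. apply Hscal. }
    unfold CSeries. cbn [Re fst].
    rewrite (Series_ext _ (fun k => w k * Re (Cexp (RtoC (r k) * x))))
      by (intros k; apply Hscal).
    apply (is_series_moments (fun t => Re (Cexp (RtoC t * x)))
             (fun n => Re (exp_coef x n)) (3 * M)).
    intros t N Ht. eapply Rle_trans; [|apply exp_bound_le; assumption].
    exact (proj1 (exp_rest_bound x N t Ht)).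
  - apply (is_series_ext
      (fun n => Series (fun k => w k * r k ^ n) * Im (exp_coef x n))).
    { intros n. symmetry. apply Hscal. }
    unfold CSeries. cbn [Im snd].
    rewrite (Series_ext _ (fun k => w k * Im (Cexp (RtoC (r k) * x))))
      by (intros k; apply Hscal).
    apply (is_series_moments (fun t => Im (Cexp (RtoC t * x)))
             (fun n => Im (exp_coef x n)) (3 * M)).
    intros t N Ht. eapply Rle_trans; [|apply exp_bound_le; assumption].
    exact (proj2 (exp_rest_bound x N t Ht)).
Qed.

End Moments.

(** * The weights of the Bessel function *)

Definition bessel_weight (k : nat) : R := / (2 ^ k * INR (fact k)) ^ 2.

Lemma two_pow_fact_pos (k : nat) : 0 < 2 ^ k * INR (fact k).
Proof.
  apply Rmult_lt_0_compat; [apply pow_lt; lra | apply INR_fact_lt_0].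
Qed.

Lemma bessel_weight_pos (k : nat) : 0 <= bessel_weight k.
Proof. apply Rlt_le, Rinv_0_lt_compat, pow_lt, two_pow_fact_pos. Qed.

Lemma S_term_weight (n k : nat) : S_term n k = bessel_weight k * INR (2 * k) ^ n.
Proof. unfold S_term, bessel_weight, Rdiv. ring. Qed.

Lemma bessel_weight_exp_moments (L : R) :
  ex_series (fun k => bessel_weight k * exp (INR (2 * k) * L)).
Proof.
  apply (ex_series_le (V := R_CompleteNormedModule) _
           (fun k => exp (2 * L) ^ k * / INR (fact k))).
  - intros k.
    match goal with |- norm ?e <= _ => change (norm e) with (Rabs e) end.
    assert (Hw := bessel_weight_pos k).
    assert (He : exp (INR (2 * k) * L) = exp (2 * L) ^ k).
    { rewrite mult_INR.
      replace (INR 2 * INR k * L) with (INR k * (2 * L)) by (simpl; ring).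
      clear Hw. generalize (2 * L); intros y. induction k as [|k IH].
      - simpl. rewrite Rmult_0_l. apply exp_0.
      - rewrite S_INR, Rmult_plus_distr_r, Rmult_1_l, exp_plus, IH. simpl. ring. }
    rewrite He.
    assert (Hy : 0 <= exp (2 * L) ^ k) by (apply pow_le, Rlt_le, exp_pos).
    rewrite Rabs_pos_eq by (apply Rmult_le_pos; assumption).
    rewrite Rmult_comm. apply Rmult_le_compat_l; [assumption|].
    unfold bessel_weight. apply Rinv_le_contravar; [apply INR_fact_lt_0|].
    assert (1 <= 2 ^ k) by (apply pow_R1_Rle; lra).
    assert (1 <= INR (fact k))
      by (apply (le_INR 1); generalize (lt_O_fact k); lia).
    assert (INR (fact k) <= 2 ^ k * INR (fact k)) by nra.
    simpl. nra.
  - exists (exp (exp (2 * L))). apply (is_series_ext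
      (fun k => scal (pow_n (exp (2 * L)) k) (/ INR (fact k)))).
    { intros k. now rewrite pow_n_pow. }
    apply is_exp_Reals.
Qed.

Lemma ex_series_S_term (n : nat) : ex_series (S_term n).
Proof.
  apply (ex_series_ext (fun k => bessel_weight k * INR (2 * k) ^ n)).
  - intros k. symmetry. apply S_term_weight.
  - apply (ex_series_moment bessel_weight (fun k => INR (2 * k))).
    + exact bessel_weight_pos.
    + intros k. apply pos_INR.
    + exact bessel_weight_exp_moments.
Qed.

Lemma S_sum_moment (n : nat) :
  S_sum n = Series (fun k => bessel_weight k * INR (2 * k) ^ n).
Proof. apply Series_ext. intros k. apply S_term_weight. Qed.

(** The coefficient form of the Bessel equation [(x d/dx)^2 I_0 = x^2 I_0];
    it is the source of the recurrence for [S_sum]. *)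
Lemma bessel_weight_S (k : nat) :
  bessel_weight (S k) * INR (2 * S k) ^ 2 = bessel_weight k.
Proof.
  unfold bessel_weight. rewrite fact_simpl, !mult_INR.
  change (2 ^ S k) with (2 * 2 ^ k). change (INR 2) with 2.
  assert (INR (fact k) <> 0) by apply INR_fact_neq_0.
  assert (2 ^ k <> 0) by (apply pow_nonzero; lra).
  assert (INR (S k) <> 0) by (apply not_0_INR; lia).
  field. auto.
Qed.

(** The term [k = 0] of [S(n+2)] vanishes; after a shift of [k] the others are
    [w_k (2k + 2)^n] by [bessel_weight_S], to be expanded by the binomial
    theorem. *)
Lemma bell2_rec_S_sum : bell2_rec S_sum.
Proof.
  intros n.
  unfold S_sum at 1. rewrite Series_incr_1 by apply ex_series_S_term.
  rewrite S_term_weight, Nat.mul_0_r, pow_i, Rmult_0_r, Rplus_0_l by lia.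
  apply is_series_unique.
  rewrite (sum_n_ext _ (fun m => Series (fun k => bessel_weight k * INR (2 * k) ^ m)
                                  * (Binomial.C n m * 2 ^ (n - m))))
    by (intros m; rewrite S_sum_moment; real_ring).
  apply (is_series_ext (fun k => bessel_weight k *
     sum_n (fun m => INR (2 * k) ^ m * (Binomial.C n m * 2 ^ (n - m))) n)).
  - intros k. rewrite S_term_weight, Nat.add_comm, pow_add, <- Rmult_assoc,
      bessel_weight_S.
    f_equal. replace (INR (2 * S k)) with (INR (2 * k) + 2)
      by (rewrite !mult_INR, (S_INR k); simpl; ring).
    rewrite binomial, <- sum_n_Reals. apply sum_n_ext. intros m. real_ring.
  - apply (is_series_sum_n_moments bessel_weight (fun k => INR (2 * k))).
    + exact bessel_weight_pos.
    + intros k. apply pos_INR.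
    + exact bessel_weight_exp_moments.
Qed.

Lemma bell2_rec_basis (a v u : nat -> R) :
  bell2_rec a -> bell2_rec v -> bell2_rec u ->
  v 0%nat = 1 -> v 1%nat = 0 -> u 0%nat = 0 -> u 1%nat = 1 ->
  forall n, a n = v n * a 0%nat + u n * a 1%nat.
Proof.
  intros Ha Hv Hu v0 v1 u0 u1 n.
  induction n as [n IH] using lt_wf_ind.
  destruct n as [|[|n]].
  - rewrite v0, u0. ring.
  - rewrite v1, u1. ring.
  - replace (S (S n)) with (n + 2)%nat by lia.
    rewrite Ha, Hv, Hu.
    rewrite <- !(sum_n_mult_r (K := R_Ring)).
    change Rplus with (@plus R_AbelianMonoid).
    rewrite <- (sum_n_plus (G := R_AbelianMonoid)).
    apply sum_n_ext_loc. intros m Hm.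
    rewrite IH by lia. real_ring.
Qed.

(** * Bessel functions as generating function and as initial values *)

Lemma Cexp_pow (z : C) (m : nat) : (Cexp z ^ m)%C = Cexp (RtoC (INR m) * z).
Proof.
  induction m as [|m IH].
  - rewrite Cexp_ray. simpl. rewrite !Rmult_0_l, exp_0, cos_0, sin_0.
    unfold RtoC. f_equal; ring.
  - rewrite Cpow_S, IH, !Cexp_ray, S_INR, !Rmult_plus_distr_r, !Rmult_1_l.
    rewrite exp_plus, cos_plus, sin_plus.
    unfold Cexp, Cmult. cbn [fst snd]. f_equal; ring.
Qed.

Lemma BesselI_0_term (z : C) (k : nat) :
  ((z / 2) ^ (2 * k + 0) / RtoC (INR (fact k) * INR (fact (k + 0))))%C =
  (RtoC (bessel_weight k) * z ^ (2 * k))%C.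
Proof.
  rewrite !Nat.add_0_r. unfold Cdiv, bessel_weight.
  assert (INR (fact k) <> 0) by apply INR_fact_neq_0.
  assert (2 ^ k <> 0) by (apply pow_nonzero; lra).
  rewrite Cpow_mult_l, <- RtoC_inv, <- RtoC_inv, <- RtoC_pow by nra.
  rewrite <- Cmult_assoc, <- RtoC_mult, Cmult_comm. f_equal. f_equal.
  rewrite pow_inv.
  replace (2 ^ (2 * k)) with ((2 ^ k) ^ 2) by (rewrite <- pow_mult; f_equal; lia).
  field. auto.
Qed.

Lemma CSeries_RtoC (a : nat -> R) : CSeries (fun k => RtoC (a k)) = RtoC (Series a).
Proof.
  unfold CSeries, RtoC. cbn [Re Im fst snd]. f_equal.
  rewrite (Series_ext _ (fun k => 0 * 0)) by (intros k; ring).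
  rewrite (Series_scal_l 0 (fun _ => 0)). ring.
Qed.

Lemma CSeries_ext (a b : nat -> C) :
  (forall k, a k = b k) -> CSeries a = CSeries b.
Proof.
  intros H. unfold CSeries. f_equal; apply Series_ext; intros k; now rewrite H.
Qed.

Lemma BesselI_0_1 : BesselI 0 1 = RtoC (S_sum 0).
Proof.
  unfold BesselI. rewrite S_sum_moment, <- CSeries_RtoC.
  apply CSeries_ext. intros k.
  rewrite BesselI_0_term, Cpow_1_l, pow_O, Rmult_1_r. apply Cmult_1_r.
Qed.

(** Once the term [k = 0], which is zero, is dropped from [S(1)], the series
    agree term by term: [(2k + 2) / (2^(k+1) (k+1)!)^2] equals
    [(1/2)^(2k+1) / (k! (k+1)!)]. *)
Lemma BesselI_1_1 : BesselI 1 1 = RtoC (S_sum 1).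
Proof.
  unfold BesselI, S_sum.
  rewrite Series_incr_1 by apply ex_series_S_term.
  replace (S_term 1 0) with 0 by (unfold S_term, Rdiv; simpl; ring).
  rewrite Rplus_0_l, <- CSeries_RtoC.
  apply CSeries_ext. intros k.
  assert (INR (fact k) <> 0) by apply INR_fact_neq_0.
  assert (2 ^ k <> 0) by (apply pow_nonzero; lra).
  assert (INR (S k) <> 0) by (apply not_0_INR; lia).
  rewrite !(Nat.add_comm _ 1). change (1 + k)%nat with (S k).
  unfold S_term. rewrite fact_simpl, !mult_INR, pow_1.
  unfold Cdiv. rewrite Cmult_1_l, <- RtoC_inv, <- RtoC_pow, <- RtoC_inv, <- RtoC_mult
    by (repeat apply Rmult_integral_contrapositive_currified; lra || auto).
  f_equal. rewrite pow_inv. change (2 ^ S k) with (2 * 2 ^ k).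
  replace (2 ^ (1 + 2 * k)) with (2 * (2 ^ k) ^ 2)
    by (rewrite <- pow_mult, Nat.mul_comm; reflexivity).
  change (INR 2) with 2. field. auto.
Qed.

Theorem theorem3p2 (v u : nat -> R)
  (v_rec : bell2_rec v) (v_0 : v 0%nat = 1) (v_1 : v 1%nat = 0)
  (u_rec : bell2_rec u) (u_0 : u 0%nat = 0) (u_1 : u 1%nat = 1) :
  (forall x : C,
     is_series (fun n : nat => (RtoC (S_sum n) * (x ^ n / RtoC (INR (fact n))))%C)
       (BesselI 0 (Cexp x)))
  /\
  (forall n : nat,
     ex_series (S_term n) /\
     RtoC (S_sum n) =
       (RtoC (v n) * BesselI 0 1 + RtoC (u n) * BesselI 1 1)%C).
Proof.
  split.
  - intros x. unfold BesselI.
    rewrite (CSeries_ext _ (fun k => (RtoC (bessel_weight k) *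
                                      Cexp (RtoC (INR (2 * k)) * x))%C))
      by (intros k; rewrite BesselI_0_term, Cexp_pow; reflexivity).
    apply (is_series_ext (V := C_NormedModule)
      (fun n => (RtoC (Series (fun k => bessel_weight k * INR (2 * k) ^ n)%R)
                 * exp_coef x n)%C)).
    + intros n. now rewrite S_sum_moment.
    + apply (is_series_complex_moments bessel_weight (fun k => INR (2 * k))).
      * exact bessel_weight_pos.
      * intros k. apply pos_INR.
      * exact bessel_weight_exp_moments.
  - intros n. split; [apply ex_series_S_term|].
    rewrite BesselI_0_1, BesselI_1_1, <- !RtoC_mult, <- RtoC_plus. f_equal.
    now apply bell2_rec_basis; [apply bell2_rec_S_sum | ..].
Qed.
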